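(* Let $X$ be a separable Banach space, $D$ a closed, bounded and convex subset of $X$, and $\tau$ a locally convex topology on $D$ containing the weak topology on $D$. Suppose $D$ is $\tau$-strongly regular but fails the $\tau$-convex point of continuity property. Then there is a nonempty closed convex subset of $D$ without extreme points; that is, $D$ fails the Krein-Milman property.
   Context: Locally convex means having a basis of convex open sets. For $C\subset D$, $\tau|_C$ is the induced topology. $D$ has the $\tau$-convex point of continuity property ($\tau$-CPCP) if for every bounded convex $C\subset D$ and every $\varepsilon>0$ there is a nonempty $\tau|_C$-open set of diameter less than $\varepsilon$. $D$ is $\tau$-strongly regular if for every bounded convex $C\subset D$ and every $\varepsilon>0$ there is a convex combination (Minkowski sum $\sum_i\lambda_iU_i$, $\lambda_i\ge0$, $\sum\lambda_i=1$) of nonempty $\tau|_C$-open sets $U_i$ with diameter less than $\varepsilon$. $D$ has the Krein-Milman property if every nonempty closed convex subset of $D$ has an extreme point. *)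

(* Defs.v *)
From HB Require Import structures.
From mathcomp Require Import all_boot all_order all_algebra.
From mathcomp Require Import all_classical all_reals all_analysis.
Set Implicit Arguments. Unset Strict Implicit. Unset Printing Implicit Defensive.
Import Order.TTheory GRing.Theory Num.Theory.
Import numFieldNormedType.Exports.
Local Open Scope classical_set_scope.
Local Open Scope ring_scope.

Section Defs.
Variables (R : realType) (X : normedModType R).

Definition convexS (A : set X) : Prop :=
  forall x y (t : R), A x -> A y -> 0 <= t -> t <= 1 -> A (t *: x + (1 - t) *: y).

Definition boundedS (A : set X) : Prop :=
  exists M : R, forall x, A x -> `|x| <= M.

Definition diam_lt (A : set X) (e : R) : Prop :=
  exists d : R, d < e /\ forall x y, A x -> A y -> `|x - y| <= d.

Definition separable_space : Prop :=
  exists S : set X, countable S /\ closure S = setT.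

Definition dual_elt (f : X -> R) : Prop :=
  (forall (a : R) (x y : X), f (a *: x + y) = a * f x + f y) /\ continuous f.

Definition weakly_open_in (D U : set X) : Prop :=
  U `<=` D /\
  forall x, U x -> exists (n : nat) (f : 'I_n -> X -> R) (e : R),
    (forall i, dual_elt (f i)) /\ 0 < e /\
    (forall y, D y -> (forall i, `|f i y - f i x| < e) -> U y).

Definition is_topology_on (D : set X) (tau : set (set X)) : Prop :=
  (forall U, tau U -> U `<=` D) /\ tau D /\ tau set0 /\
  (forall U V, tau U -> tau V -> tau (U `&` V)) /\
  (forall (I : Type) (F : I -> set X), (forall i, F i `<=` D) ->
     (forall i, tau (F i)) -> tau (\bigcup_i F i)).

Definition tau_locally_convex (tau : set (set X)) : Prop :=
  forall U x, tau U -> U x -> exists V, tau V /\ convexS V /\ V x /\ V `<=` U.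

Definition contains_weak (D : set X) (tau : set (set X)) : Prop :=
  forall U, weakly_open_in D U -> tau U.

Definition rel_open (tau : set (set X)) (C W : set X) : Prop :=
  exists U, tau U /\ W = U `&` C.

Definition tau_CPCP (D : set X) (tau : set (set X)) : Prop :=
  forall C : set X, C `<=` D -> C !=set0 -> boundedS C -> convexS C ->
  forall e : R, 0 < e ->
    exists W, rel_open tau C W /\ W !=set0 /\ diam_lt W e.

Definition conv_comb (n : nat) (l : 'I_n -> R) (U : 'I_n -> set X) : set X :=
  [set z | exists u : 'I_n -> X, (forall i, U i (u i)) /\
                                z = \sum_(i < n) l i *: u i].

Definition tau_strongly_regular (D : set X) (tau : set (set X)) : Prop :=
  forall C : set X, C `<=` D -> C !=set0 -> boundedS C -> convexS C ->
  forall e : R, 0 < e ->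
    exists (n : nat) (l : 'I_n -> R) (U : 'I_n -> set X),
      (forall i, 0 <= l i) /\ \sum_(i < n) l i = 1 /\
      (forall i, rel_open tau C (U i) /\ U i !=set0) /\
      diam_lt (conv_comb l U) e.

Definition extreme_point (K : set X) (x : X) : Prop :=
  K x /\ forall y z (t : R), K y -> K z -> 0 < t -> t < 1 ->
    x = t *: y + (1 - t) *: z -> y = z.

Definition KMP (D : set X) : Prop :=
  forall K : set X, K `<=` D -> K !=set0 -> closed K -> convexS K ->
    exists x, extreme_point K x.
End Defs.

(* Main.v *)
(* Let C be a convex subset of D all of whose nonempty relatively tau-open
   subsets have diameter at least e0.  Strong regularity produces a tree of
   convex relatively open sets U_i (i in I_n, n = 0, 1, ...), with weights lam_n
   on I_n compatible with the tree, such that the diameter of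
   sum_i lam_n(i) U_i tends to 0.  Moreover, by Hahn-Banach, the U_i of level
   n + 1 can be shrunk so that for *every* weight mu on that level, either
   sum_i mu(i) U_i has diameter at most 2 r_n or it misses the ball of radius
   r_n / 8 about c_n, where (c_n, r_n) runs through a countable dense set of
   centres and the radii 1/(m+1).
   Let K be the intersection of the sets cl conv (U_i : i in I_n).  A point z of
   K comes, by compactness, from a probability mu on the branches, in the sense
   that z is in cl (sum_i mu(i) U_i) at each level; the second alternative is
   then excluded when c_n is close to z, so the diameters tend to 0 and mu, as
   well as each of its restrictions, determines a point.  For a small r_n and c_n
   close to z the first alternative fails for the point masses, so all U_i of
   that level stay away from z: splitting mu along a node i with mu(i) > 0
   shows that z is not extreme. *)
Require Import Defs.
From mathcomp Require Import all_boot all_order all_algebra.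
From mathcomp Require Import ring lra.
From mathcomp Require Import all_classical all_reals all_analysis.
Set Implicit Arguments. Unset Strict Implicit. Unset Printing Implicit Defensive.
Import Order.TTheory GRing.Theory Num.Theory.
Import numFieldNormedType.Exports.
Local Open Scope classical_set_scope.
Local Open Scope ring_scope.

(** * Norming functionals *)

Section NormingFunctional.
Variables (R : realType) (X : normedModType R).
Implicit Types (p q : X -> R) (x y z : X).

Definition sublinear p : Prop :=
  (forall x y, p (x + y) <= p x + p y) /\
  (forall (t : R) x, 0 <= t -> p (t *: x) <= t * p x).

Lemma sublinear0 p : sublinear p -> p 0 = 0.
Proof.
move=> [pD pZ]; have := pD 0 0; have := pZ 0 0 (lexx _).
by rewrite scale0r addr0; lra.
Qed.

Lemma sublinear_ge p x : sublinear p -> - p (- x) <= p x.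
Proof. by move=> sp; have := sp.1 x (- x); rewrite subrr sublinear0//; lra. Qed.

Lemma sublinearZ p (t : R) x : sublinear p -> 0 <= t -> p (t *: x) = t * p x.
Proof.
move=> sp t0; have [->|tn0] := eqVneq t 0.
  by rewrite scale0r mul0r sublinear0.
have tp : 0 < t by rewrite lt_neqAle eq_sym tn0.
apply: le_anti; rewrite sp.2//=.
have := sp.2 t^-1 (t *: x); rewrite invr_ge0 => /(_ t0).
by rewrite scalerA mulVf// scale1r ler_pdivlMl.
Qed.

Lemma sublinear_norm : sublinear (fun x => `|x|).
Proof. by split=> [x y|t x t0]; rewrite ?ler_normD// normrZ ger0_norm. Qed.

Lemma le_add_inf (A B : set R) (z : R) : A !=set0 -> B !=set0 ->
  (forall a b, A a -> B b -> z <= a + b) -> z <= inf A + inf B.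
Proof.
move=> A0 B0 AB; rewrite -lerBlDl; apply: lb_le_inf => // b Bb.
rewrite lerBlDl addrC -lerBlDl; apply: lb_le_inf => // a Aa.
by rewrite lerBlDl addrC AB.
Qed.

(** For sublinear [p], the largest sublinear minorant of [p] whose value at [- y] is at most
    [- p y]. *)
Definition directional p y x : R :=
  inf [set p (x + t *: y) - t * p y | t in [set t | 0 <= t]].

Lemma directional_lb p y x : sublinear p ->
  lbound [set p (x + t *: y) - t * p y | t in [set t | 0 <= t]] (- p (- x)).
Proof.
move=> sp _ /= [t t0 <-]; have := sp.1 (x + t *: y) (- x).
by rewrite addrAC subrr add0r sublinearZ//; lra.
Qed.

Lemma directional_le p y x t : sublinear p -> 0 <= t ->
  directional p y x <= p (x + t *: y) - t * p y.
Proof.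
move=> sp t0; apply: ge_inf; last by exists t.
by exists (- p (- x)); exact: directional_lb.
Qed.

Lemma directional_nonempty p y x :
  [set p (x + t *: y) - t * p y | t in [set t | 0 <= t]] !=set0.
Proof. by eexists; exists 0 => //=. Qed.

(** The infimum runs over a cone of parameters: [s] for [x] and [s'] for [x'] yield [s + s'] for the
    sum, and [t * s] serves for [t *: x]. *)
Lemma sublinear_directional p y : sublinear p -> sublinear (directional p y).
Proof.
move=> sp; split=> [x x'|t x t0].
  apply: le_add_inf => [||_ _ [s s0 <-] [s' s'0 <-]]; try exact: directional_nonempty.
  apply: le_trans (directional_le y (x + x') sp (addr_ge0 s0 s'0)) _.
  have := sp.1 (x + s *: y) (x' + s' *: y).
  by rewrite scalerDl addrACA mulrDl; lra.
have [->|tn0] := eqVneq t 0.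
  rewrite scale0r mul0r; have := @directional_le p y 0 0 sp (lexx _).
  by rewrite scale0r addr0 mul0r subr0 (sublinear0 sp).
have tp : 0 < t by rewrite lt_neqAle eq_sym tn0.
rewrite -ler_pdivrMl//; apply: lb_le_inf; first exact: directional_nonempty.
move=> _ /= [s s0 <-]; rewrite ler_pdivrMl//.
apply: le_trans (directional_le y (t *: x) sp (mulr_ge0 t0 s0)) _.
have := sp.2 t (x + s *: y) t0.
by rewrite scalerDr scalerA mulrBr mulrA; lra.
Qed.

Lemma directional_le_id p y x : sublinear p -> directional p y x <= p x.
Proof.
move=> sp; have := @directional_le p y x 0 sp (lexx _).
by rewrite scale0r addr0 mul0r subr0.
Qed.

Lemma directional_opp p y : sublinear p -> directional p y (- y) <= - p y.
Proof.
move=> sp; have := @directional_le p y (- y) 1 sp ler01.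
by rewrite scale1r addNr mul1r sublinear0// sub0r.
Qed.

(* A minimal sublinear functional [p] equals its own directional minorants, so
   that [p (- y) <= - p y] for all [y], which makes it linear. *)
Lemma exists_linear_le q : sublinear q ->
  exists p, [/\ sublinear p, (forall x, p x <= q x) & forall x, p (- x) = - p x].
Proof.
move=> sq; pose T := {p | sublinear p /\ forall x, p x <= q x}.
(* The order is reversed, so the maximal element given by Zorn's lemma is a minimal functional. *)
pose Rl (p1 p2 : T) := `[< forall x, sval p2 x <= sval p1 x >].
have t0 : T by exists q; split.
have [|||[p [sp pq]] pmax] := @ZL_preorder T t0 Rl.
- by move=> t; apply/asboolP.
- move=> r s t /asboolP rs /asboolP st; apply/asboolP => x.
  exact: le_trans (st x) (rs x).
- move=> A Atot; have [[a0 Aa0]|A0] := pselect (A !=set0); last first.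
    by exists t0 => s As; exfalso; apply: A0; exists s.
  (* A nonempty chain is bounded by its pointwise infimum, finite because each member is at least
     [- q (- x)] at [x]. *)
  pose V x := [set sval a x | a in A].
  have V0 x : V x !=set0 by exists (sval a0 x); exists a0.
  have Vlb x : has_lbound (V x).
    exists (- q (- x)) => _ [[p [sp pq]] Ap <-] /=.
    by apply: le_trans (sublinear_ge _ sp); rewrite lerN2.
  have infle a x : A a -> inf (V x) <= sval a x.
    by move=> Aa; apply: ge_inf => //; exists a.
  have infP : sublinear (fun x => inf (V x)) /\ forall x, inf (V x) <= q x.
    split; last by move=> x; apply: le_trans (infle _ _ Aa0) _; case: (svalP a0).
    split=> [x y|t x t0'].
      apply: le_add_inf => // _ _ [a Aa <-] [b Ab <-].
      (* The smaller of [a] and [b] is used at both points. *)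
      have [/asboolP ab|/asboolP ab] := Atot _ _ Aa Ab.
        apply: le_trans (infle _ _ Ab) _.
        by apply: le_trans ((svalP b).1.1 x y) _; rewrite lerD2r.
      apply: le_trans (infle _ _ Aa) _.
      by apply: le_trans ((svalP a).1.1 x y) _; rewrite lerD2l.
    have [->|tn0] := eqVneq t 0.
      rewrite scale0r mul0r; apply: le_trans (infle _ _ Aa0) _.
      by rewrite sublinear0//; case: (svalP a0).
    have tp : 0 < t by rewrite lt_neqAle eq_sym tn0.
    rewrite -ler_pdivrMl//; apply: lb_le_inf => // _ [a Aa <-].
    rewrite ler_pdivrMl//; apply: le_trans (infle _ _ Aa) _.
    exact: (svalP a).1.2.
  exists (exist (fun p => sublinear p /\ forall x, p x <= q x) _ infP) => s As.
  by apply/asboolP => x /=; exact: infle.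
exists p; split=> // y; apply: le_anti; apply/andP; split.
  have dP : sublinear (directional p y) /\ forall x, directional p y x <= q x.
    split; first exact: sublinear_directional.
    by move=> x; exact: le_trans (directional_le_id _ _ sp) (pq x).
  have /pmax/asboolP/= pd : Rl (exist _ p (conj sp pq))
      (exist (fun p => sublinear p /\ forall x, p x <= q x) _ dP).
    by apply/asboolP => x /=; exact: directional_le_id.
  exact: le_trans (pd _) (directional_opp _ sp).
by have := sublinear_ge y sp; lra.
Qed.

(** A linear minorant of the directional minorant of the norm at [y] is at most minus the norm of
    [y] at [- y], hence it norms [y]. *)
Lemma norming_functional (y : X) : exists g : X -> R,
  [/\ dual_elt g, (forall x, `|g x| <= `|x|) & g y = `|y|].
Proof.
have sd := sublinear_directional y sublinear_norm.
have [p [sp pd pN]] := exists_linear_le sd.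
have pn x : p x <= `|x| by exact: le_trans (pd x) (directional_le_id _ _ sublinear_norm).
have pn' x : `|p x| <= `|x|.
  by rewrite ler_norml pn andbT lerNl -pN -normrN pn.
have pD x z : p (x + z) = p x + p z.
  apply: le_anti; rewrite sp.1/=.
  by have := sp.1 (- x) (- z); rewrite -opprD !pN; lra.
have pZ (t : R) x : p (t *: x) = t * p x.
  have [t0|t0] := leP 0 t; first exact: sublinearZ.
  have := @sublinearZ p (- t) x sp; rewrite oppr_ge0 => /(_ (ltW t0)).
  by rewrite scaleNr pN; lra.
exists p; split=> //; last first.
  apply: le_anti; rewrite pn/= -lerN2 -pN.
  exact: le_trans (pd _) (directional_opp y sublinear_norm).
split=> [a x z|x]; first by rewrite pD pZ.
apply/cvgrPdist_lt => e e0; near=> z.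
rewrite -pN -pD; apply: le_lt_trans (pn' _) _.
by near: z; exact: cvgr_dist_lt.
Unshelve. all: by end_near. Qed.

End NormingFunctional.

(** * Ultrafilter limits, convex combinations of reals, sums over tagged unions *)

Lemma ultra_cvg01 (R : realType) (T : Type) (G : set_system T) (f : T -> R) :
  UltraFilter G -> (forall k, 0 <= f k <= 1) ->
  exists l : R, 0 <= l <= 1 /\ f k @[k --> G] --> l.
Proof.
move=> GU f01.
have PG : ProperFilter (fmap f G) by apply: fmap_proper_filter; exact: ultra_proper.
have f01' : fmap f G `[0, 1]%classic.
  by apply: (@filterS _ G _ setT) => [k _|]; [rewrite /= in_itv; exact: f01|exact: filterT].
have [l [/= l01 lf]] := segment_compact PG f01'.
exists l; split; first by move: l01; rewrite in_itv.
(* A cluster point along an ultrafilter is a limit: if the preimage of [B] is not in [G], that of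
   its complement is, and the complement would have to meet [B]. *)
move=> B lB; have [//|GnB] := in_ultra_setVsetC (f @^-1` B) GU.
by have [x [nBx Bx]] := lf (~` B) B GnB lB.
Qed.

Lemma convex_comb_lt (R : realType) (t a b d : R) :
  0 <= t -> t <= 1 -> a < d -> b < d -> t * a + (1 - t) * b < d.
Proof.
move=> t0 t1 ad bd; have md : Num.max a b < d by rewrite gt_max ad.
apply: le_lt_trans md; have [?|?] := leP a b; nra.
Qed.

Lemma sum_tagged (V : nmodType) (I : finType) (n : I -> nat) (P : pred I)
    (F : {i : I & 'I_(n i)} -> V) :
  \sum_(j | P (tag j)) F j =
  \sum_(i | P i) \sum_(k < n i) F (existT (fun i => 'I_(n i)) i k).
Proof.
rewrite (@sig_big_dep _ _ _ I (fun i => 'I_(n i)) P (fun _ => xpredT)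
  (fun i k => F (existT (fun i => 'I_(n i)) i k))) /=.
by apply: eq_big => [j|[i k] _]; rewrite ?andbT.
Qed.

(** * Weighted Minkowski sums *)

Section MinkowskiCombinations.
Variables (R : realType) (X : normedModType R).
Implicit Types (A S : set X).

(** Weights need not sum to 1, so that a weight restricted to part of the index set is allowed. *)
Definition comb (I : finType) (w : I -> R) (U : I -> set X) : set X :=
  [set z | exists u : I -> X, (forall i, U i (u i)) /\ z = \sum_i w i *: u i].

(** The image measure, when weights are seen as measures on finite sets. *)
Definition push (I J : finType) (p : J -> I) (w : J -> R) (i : I) : R :=
  \sum_(j | p j == i) w j.

Definition diam_le A (d : R) := forall x y, A x -> A y -> `|x - y| <= d.

Lemma closure_normP A (a : X) :
  closure A a <-> forall e, 0 < e -> exists2 y, A y & `|a - y| < e.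
Proof.
split=> [Aa e e0|Aa B].
  have [y [Ay ay]] := Aa _ (nbhsx_ballx a e e0).
  by exists y => //; move: ay; rewrite -ball_normE.
move=> /nbhs_ballP[e /= e0 eB]; have [y Ay ay] := Aa _ e0.
by exists y; split => //; apply: eB; rewrite -ball_normE.
Qed.

(** Cantor's intersection theorem, with closures because the [S n] are not assumed closed. *)
Lemma nested_point (Y : completeNormedModType R) (S : nat -> set Y) :
  (forall n, S n !=set0) -> (forall n, S n.+1 `<=` S n) ->
  (forall e, 0 < e -> exists n, forall x y, S n x -> S n y -> `|x - y| <= e) ->
  exists a, forall n, closure (S n) a.
Proof.
move=> S0 Sdec Sd; have [s Ss] := choice S0.
have Sle m n : (m <= n)%N -> S n `<=` S m.
  move=> /subnK<-; elim: (n - m)%N => // k IH; rewrite addSn.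
  exact: subset_trans (Sdec _) IH.
have : cvg (s @ \oo).
  apply: cauchy_cvg; apply: cauchy_exP => e e0.
  have [n Sn] := Sd (e / 2) (divr_gt0 e0 (ltr0n _ 2)).
  exists (s n); exists n => // k /= nk; rewrite -ball_normE /=.
  by apply: le_lt_trans (Sn _ _ (Ss n) (Sle _ _ nk _ (Ss k))) _; lra.
move=> /cvg_ex[a sa]; exists a => n B Ba.
have [N _ NB] := sa _ Ba; exists (s (maxn n N)); split.
  exact: Sle (leq_maxl _ _) _ (Ss _).
exact: NB (leq_maxr _ _).
Qed.

(* The conical form of the convexity of [A] needs no normalised weights. *)
Lemma convex_cone_sum A (I : Type) (s : seq I) (P : pred I) (w : I -> R)
    (u : I -> X) :
  convexS A -> A !=set0 -> (forall i, P i -> 0 <= w i) ->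
  (forall i, P i -> A (u i)) ->
  exists2 a, A a & \sum_(i <- s | P i) w i *: u i = (\sum_(i <- s | P i) w i) *: a.
Proof.
move=> cA [a0 Aa0] w0 Au; elim: s => [|i s [a Aa IH]].
  by exists a0 => //; rewrite !big_nil scale0r.
rewrite !big_cons; case: ifPn => [Pi|_]; last by exists a.
set W := \sum_(j <- s | P j) w j; have W0 : 0 <= W by apply: sumr_ge0.
have wi0 := w0 i Pi; have [W'0|W'0] := eqVneq (w i + W) 0.
  have [-> W00] : w i = 0 /\ W = 0 by lra.
  by exists a0 => //; rewrite IH -/W W00 addr0 !scale0r addr0.
have W'p : 0 < w i + W by rewrite lt_neqAle eq_sym W'0 addr_ge0.
exists ((w i / (w i + W)) *: u i + (1 - w i / (w i + W)) *: a).
  apply: cA => //; first exact: Au.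
    by rewrite divr_ge0// ltW.
  by rewrite ler_pdivrMr// mul1r; lra.
rewrite IH -/W scalerDr !scalerA; congr (_ *: _ + _ *: _); by field.
Qed.

Lemma comb_nonempty (I : finType) (w : I -> R) (U : I -> set X) :
  (forall i, U i !=set0) -> comb w U !=set0.
Proof.
by move=> U0; have [u Uu] := choice U0; exists (\sum_i w i *: u i), u.
Qed.

(** The points in the fibre over [i] all lie in the convex set [U i], so their weighted sum is the
    mass of the fibre times one point of [U i]. *)
Lemma comb_push (I J : finType) (p : J -> I) (w : J -> R) (U : I -> set X)
    (V : J -> set X) :
  (forall i, convexS (U i)) -> (forall i, U i !=set0) ->
  (forall j, 0 <= w j) -> (forall j, V j `<=` U (p j)) ->
  comb w V `<=` comb (push p w) U.
Proof.
move=> cU U0 w0 VU _ [u [Vu ->]].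
have /choice[v Uv] i : exists v, U i v /\
    \sum_(j | p j == i) w j *: u j = push p w i *: v.
  have [//|//|j _ //|j /eqP<-|a Ua e] :=
    @convex_cone_sum (U i) J (index_enum J) (fun j => p j == i) w u.
  - exact: VU.
  - by exists a.
exists v; split=> [i|]; first by case: (Uv i).
rewrite (partition_big p xpredT)//=; apply: eq_bigr => i _.
by case: (Uv i).
Qed.

Lemma sum_push (I J : finType) (p : J -> I) (w : J -> R) :
  \sum_i push p w i = \sum_j w j.
Proof. by rewrite [RHS](partition_big p xpredT). Qed.

Lemma push_ge0 (I J : finType) (p : J -> I) (w : J -> R) i :
  (forall j, 0 <= w j) -> 0 <= push p w i.
Proof. by move=> w0; apply: sumr_ge0. Qed.

Definition restrict_weight (I : finType) (P : pred I) (w : I -> R) (i : I) : R :=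
  if P i then w i else 0.

Lemma comb_restrictD (I : finType) (P : pred I) (w : I -> R) (U : I -> set X) x y :
  comb (restrict_weight P w) U x -> comb (restrict_weight (predC P) w) U y ->
  comb w U (x + y).
Proof.
move=> [u [Uu ->]] [v [Uv ->]]; exists (fun i => if P i then u i else v i).
split=> [i|]; first by case: ifP.
rewrite -big_split; apply: eq_bigr => i _ /=; rewrite /restrict_weight /=.
by case: (P i); rewrite scale0r ?addr0 ?add0r.
Qed.

(** Adding one fixed point for the complementary weight to two points of the restricted sum gives
    points of the full sum with the same difference. *)
Lemma diam_restrict (I : finType) (P : pred I) (w : I -> R) (U : I -> set X) e :
  (forall i, U i !=set0) -> diam_le (comb w U) e ->
  diam_le (comb (restrict_weight P w) U) e.
Proof.
move=> U0 wU x y xU yU.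
have [z zU] := comb_nonempty (restrict_weight (predC P) w) U0.
have := wU _ _ (comb_restrictD xU zU) (comb_restrictD yU zU).
by rewrite opprD addrACA subrr addr0.
Qed.

End MinkowskiCombinations.

(** * The core of a tower of convex sets *)

Section Tower.
Variables (R : realType) (X : completeNormedModType R).
Variables (I : nat -> finType) (p : forall n, I n.+1 -> I n).
Variable U : forall n, I n -> set X.
Arguments U : clear implicits.
Hypothesis cU : forall n i, convexS (U n i).
Hypothesis U0 : forall n i, U n i !=set0.
Hypothesis Usub : forall n j, U n.+1 j `<=` U n (p j).
Variable M : R.
Hypothesis UM : forall n i x, U n i x -> `|x| <= M.

Definition prob_weight (J : finType) (w : J -> R) : Prop :=
  (forall i, 0 <= w i) /\ \sum_i w i = 1.

(** Together with [prob_weight], this describes a probability on the branches of the tree by its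
    masses at the nodes. *)
Definition consistent (nu : forall n, I n -> R) : Prop :=
  forall n, push (@p n) (nu n.+1) = nu n.

(** As the [U n i] are convex, this is the convex hull of their union over [i]. *)
Definition hull n : set X :=
  [set z | exists w : I n -> R, prob_weight w /\ comb w (U n) z].

Definition core : set X := [set z | forall n, closure (hull n) z].

Lemma hull_dec m n : (m <= n)%N -> hull n `<=` hull m.
Proof.
move=> /subnK<-; elim: (n - m)%N => // k IH; rewrite addSn.
apply: subset_trans IH => z [w [[w0 w1] wz]]; exists (push (@p _) w).
split; first by split=> [i|]; [exact: push_ge0|rewrite sum_push].
exact: (comb_push (@cU _) (@U0 _) w0 (@Usub _)) _ wz.
Qed.

Lemma prob_weight_le1 (J : finType) (w : J -> R) i : prob_weight w -> w i <= 1.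
Proof.
by move=> [w0 <-]; rewrite (bigD1 i)//= lerDl sumr_ge0.
Qed.

Lemma convex_hull n : convexS (hull n).
Proof.
move=> x y t [v [[v0 v1] [a [Ua ->]]]] [w [[w0 w1] [b [Ub ->]]]] t0 t1.
have t1' : 0 <= 1 - t by rewrite subr_ge0.
exists (fun i => t * v i + (1 - t) * w i); split.
  split=> [i|]; first by rewrite addr_ge0// mulr_ge0.
  by rewrite big_split/= -!mulr_sumr v1 w1; ring.
have /choice[c cP] i : exists c, U n i c /\
    t *: (v i *: a i) + (1 - t) *: (w i *: b i) = (t * v i + (1 - t) * w i) *: c.
  have [//|//|k _|k _|c Uc] := @convex_cone_sum R X (U n i) _ (index_enum bool) xpredT
    (fun k : bool => if k then t * v i else (1 - t) * w i)
    (fun k => if k then a i else b i).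
  - by case: k; rewrite mulr_ge0.
  - by case: k; [exact: Ua|exact: Ub].
  by rewrite !big_bool /= !scalerA => e; exists c.
exists c; split=> [i|]; first by case: (cP i).
rewrite !scaler_sumr -big_split; apply: eq_bigr => i _ /=; by case: (cP i).
Qed.

Lemma convex_closure (A : set X) : convexS A -> convexS (closure A).
Proof.
move=> cA x y t /closure_normP Ax /closure_normP Ay t0 t1.
apply/closure_normP => e e0.
have [x' Ax' xx'] := Ax _ e0; have [y' Ay' yy'] := Ay _ e0.
exists (t *: x' + (1 - t) *: y'); first exact: cA.
have -> : t *: x + (1 - t) *: y - (t *: x' + (1 - t) *: y') =
    t *: (x - x') + (1 - t) *: (y - y').
  by rewrite !scalerBr opprD addrACA.
apply: le_lt_trans (ler_normD _ _) _; rewrite !normrZ (ger0_norm t0) ger0_norm ?subr_ge0//.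
exact: convex_comb_lt.
Qed.

Lemma convex_core : convexS core.
Proof.
move=> x y t Kx Ky t0 t1 n.
exact: (convex_closure (@convex_hull n)) (Kx n) (Ky n) t0 t1.
Qed.

Lemma closed_core : closed core.
Proof.
have -> : core = \bigcap_n closure (hull n).
  by apply/seteqP; split=> z Kz n *; exact: Kz.
by apply: closed_bigI => n _; exact: closed_closure.
Qed.

Lemma comb_dec (nu : forall n, I n -> R) : (forall n i, 0 <= nu n i) ->
  consistent nu -> forall m n, (m <= n)%N ->
  comb (nu n) (U n) `<=` comb (nu m) (U m).
Proof.
move=> nu0 nuc m n /subnK<-; elim: (n - m)%N => // k IH; rewrite addSn.
apply: subset_trans IH; rewrite -[nu (k + m)%N]nuc.
exact: comb_push.
Qed.

Lemma core_nonempty (nu : forall n, I n -> R) :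
  (forall n, prob_weight (nu n)) -> consistent nu ->
  (forall e, 0 < e -> exists n, diam_le (comb (nu n) (U n)) e) ->
  core !=set0.
Proof.
move=> nup nuc nud.
have [|n|//|a aP] := @nested_point R X (fun n => comb (nu n) (U n)).
- by move=> n; exact: comb_nonempty.
- by apply: comb_dec => // k i; case: (nup k) => /(_ i).
exists a => n; apply: closureS (aP n) => z nz.
by exists (nu n).
Qed.

Lemma family_update (T : nat -> Type) (be : forall n, T n) k (w : T k) :
  exists be' : forall n, T n, be' k = w /\ forall n, n != k -> be' n = be n.
Proof.
exists (dfwith be k w); split=> [|n nk]; first exact: dfwithin.
by rewrite dfwithout// eq_sym.
Qed.

(** The weight [w] is pushed down level by level, and [x] stays in the sums by [comb_push]. *)
Lemma backward_weights k (w : I k -> R) x : prob_weight w -> comb w (U k) x ->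
  exists be : forall n, I n -> R,
  [/\ forall n i, 0 <= be n i <= 1,
      forall n, (n <= k)%N -> prob_weight (be n) /\ comb (be n) (U n) x,
      forall n, (n < k)%N -> push (@p n) (be n.+1) = be n & be k = w].
Proof.
elim: k w => [|k IH] w wp wx.
  (* Weights above level [k] are 0, which keeps all levels bounded as the later passage to limits
     requires. *)
  have [be [be0 bene]] := @family_update (fun n => I n -> R) (fun n _ => 0) 0%N w.
  exists be; split=> // [n i|n].
    move: i; have [->|n0 i] := eqVneq n 0%N; last by rewrite bene// lexx ler01.
    by move=> i; rewrite be0 (prob_weight_le1 _ wp) wp.1.
  by rewrite leqn0 => /eqP->; rewrite be0.
have wp' : prob_weight (push (@p k) w).
  by split=> [i|]; [exact: push_ge0 wp.1|rewrite sum_push wp.2].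
have wx' := comb_push (@cU _) (@U0 _) wp.1 (@Usub _) wx.
have [be [be01 bep bec bek]] := IH _ wp' wx'.
have [be' [be'0 be'ne]] := @family_update (fun n => I n -> R) be k.+1 w.
have be'le n : (n <= k)%N -> be' n = be n.
  by move=> nk; rewrite be'ne// neq_ltn ltnS nk.
exists be'; split=> [n i|n|n|//].
- move: i; have [->|n0 i] := eqVneq n k.+1; last by rewrite be'ne.
  by move=> i; rewrite be'0 (prob_weight_le1 _ wp) wp.1.
- rewrite leq_eqVlt ltnS => /predU1P[->|nk]; first by rewrite be'0.
  by rewrite be'le//; exact: bep.
- rewrite ltnS leq_eqVlt => /predU1P[->|nk]; last first.
    by rewrite !be'le ?(ltnW nk)// bec.
  by rewrite be'0 be'le.
Qed.

Lemma cvg_sum_finite (T : Type) (F : set_system T) (J : finType) (P : pred J)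
    (f : J -> T -> R) (l : J -> R) : Filter F ->
  (forall j, f j k @[k --> F] --> l j) ->
  \sum_(j | P j) f j k @[k --> F] --> \sum_(j | P j) l j.
Proof. by move=> FF fl; apply: cvg_big => //; exact: add_continuous. Qed.

(** Points of [hull k] tending to [z] carry weights [B k] on the levels up to [k]. Along an
    ultrafilter containing every tail all coordinates converge at once, and the finite sums pass to
    the limit [mu]. *)
Lemma core_weights z : core z -> exists mu : forall n, I n -> R,
  [/\ forall n, prob_weight (mu n), consistent mu &
      forall n, closure (comb (mu n) (U n)) z].
Proof.
move=> Kz.
have /choice[B BP] k : exists be : forall n, I n -> R, exists x, `|z - x| < k.+1%:R^-1 /\
  [/\ forall n i, 0 <= be n i <= 1,
      forall n, (n <= k)%N -> prob_weight (be n) /\ comb (be n) (U n) x &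
      forall n, (n < k)%N -> push (@p n) (be n.+1) = be n].
  have [|x [w [wp wx]] zx] := (closure_normP _ _).1 (Kz k) k.+1%:R^-1.
    by rewrite invr_gt0.
  have [be [be01 bep bec _]] := backward_weights wp wx.
  by exists be, x.
have [G [GU sG]] := ultraFilterLemma eventually_filter.
have PG : ProperFilter G by exact: ultra_proper.
have B01 n i k : 0 <= B k n i <= 1 by have [x [_ []]] := BP k.
pose mu n i := projT1 (cid (ultra_cvg01 GU (B01 n i))).
have mu01 n i : 0 <= mu n i <= 1.
  by rewrite /mu; case: cid => /= l [].
have Bmu n i : B k n i @[k --> G] --> mu n i.
  by rewrite /mu; case: cid => /= l [].
have near_gt n : \forall k \near G, (n < k)%N by apply: sG; exact: nbhs_infty_gt.
have uniqG (f : nat -> R) (a b : R) : f k @[k --> G] --> a -> f k @[k --> G] --> b -> a = b.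
  by move=> fa fb; rewrite -(cvg_lim (@Rhausdorff R) fa) (cvg_lim (@Rhausdorff R) fb).
exists mu; split.
- move=> n; split=> [i|]; first by case/andP: (mu01 n i).
  apply: (uniqG (fun k => \sum_i B k n i)); first exact: cvg_sum_finite.
  apply: cvg_near_cst; apply: filterS (near_gt n) => k nk.
  by have [x [_ [_ /(_ n (ltnW nk))[[]]]]] := BP k.
- move=> n; apply/funext => i.
  apply: (uniqG (fun k => push (@p n) (B k n.+1) i)); first exact: cvg_sum_finite.
  apply: cvg_trans (Bmu n i); apply: near_eq_cvg.
  apply: filterS (near_gt n) => k nk.
  by have [x [_ [_ _ /(_ n nk)->]]] := BP k.
move=> n; apply/closure_normP => e e0.
(* Replacing [B k n] by [mu n] changes a sum of [#|I n|] terms with points of norm at most [M] by at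
   most [e / 2]; both [+ 1] keep the divisors positive. *)
pose d := e / 2 / (`|M| + 1) / (#|I n|%:R + 1).
have d0 : 0 < d by rewrite !divr_gt0// ltr_wpDl.
have near_d : \forall k \near G, forall i, `|mu n i - B k n i| < d.
  by apply: filter_forall => i; move/cvgrPdist_lt : (Bmu n i); exact.
have near_e : \forall k \near G, k.+1%:R^-1 < e / 2.
  by apply: sG; exact: (near_infty_natSinv_lt (PosNum (divr_gt0 e0 (ltr0n R 2)))).
have [k [kd [ke nk]]] := filter_ex (filterI near_d (filterI near_e (near_gt n))).
have [x [zx [_ /(_ n (ltnW nk))[_ [u [Uu xe]]] _]]] := BP k.
exists (\sum_i mu n i *: u i); first by exists u.
rewrite -(subrK x z) -addrA; apply: le_lt_trans (ler_normD _ _) _.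
rewrite {2}xe -sumrB.
have : `|\sum_i (B k n i *: u i - mu n i *: u i)| <= e / 2.
  apply: le_trans (ler_norm_sum _ _ _) _.
  apply: (@le_trans _ _ (\sum_(i : I n) d * (`|M| + 1))).
    apply: ler_sum => i _; rewrite -scalerBl normrZ distrC.
    apply: ler_pM => //; first exact: ltW.
    by apply: le_trans (UM (Uu i)) _; have := ler_norm M; lra.
  rewrite sumr_const -[leLHS]mulr_natr /d.
  set N := #|I n|%:R; have N0 : 0 <= N by [].
    have -> : e / 2 / (`|M| + 1) / (N + 1) * (`|M| + 1) * N = e / 2 * (N / (N + 1)).
    by field; rewrite !gt_eqF ?ltr_wpDl.
  by rewrite ler_piMr ?divr_ge0 ?ltW// ltr_pdivrMr ?ltr_wpDl// mul1r ltrDl.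
have ze : `|z - x| < e / 2 by exact: lt_trans zx ke.
by move=> sle; rewrite [ltRHS]splitr ltr_leD.
Qed.

(** With the offset on the right, [n.+1 + n0] computes to [(n + n0).+1], so no cast between index
    types is needed. *)
Fixpoint ancestor n0 n : I (n + n0)%N -> I n0 :=
  if n is m.+1 then fun j => ancestor (p j) else id.

(** As [P] passes unchanged from a node to its children, the restricted weights stay consistent with
    constant mass [t]; dividing by [t] puts the point in the core. *)
Lemma restricted_point (mu : forall n, I n -> R) n0
    (P : forall n, pred (I (n + n0)%N)) :
  (forall n, prob_weight (mu n)) -> consistent mu ->
  (forall e, 0 < e -> exists n, diam_le (comb (mu n) (U n)) e) ->
  (forall n j, P n.+1 j = P n (p j)) ->
  exists a, (forall n, closure
      (comb (restrict_weight (P n) (mu (n + n0)%N)) (U (n + n0)%N)) a) /\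
    let t := \sum_i restrict_weight (P 0%N) (mu n0) i in
    (0 < t -> core (t^-1 *: a)).
Proof.
move=> mup muc mud PE.
pose nu n := restrict_weight (P n) (mu (n + n0)%N).
have nu0 n i : 0 <= nu n i.
  by rewrite /nu /restrict_weight; case: ifP => // _; exact: (mup _).1.
have nuc n : push (@p (n + n0)%N) (nu n.+1) = nu n.
  apply/funext => i; rewrite /nu /restrict_weight -[mu (n + n0)%N]muc /push.
  case: ifPn => Pi; last first.
    by rewrite big1// => j /eqP ji; rewrite PE ji (negbTE Pi).
  by apply: eq_bigr => j /eqP ji; rewrite PE ji Pi.
have [|n||a aP] := @nested_point R X (fun n => comb (nu n) (U (n + n0)%N)).
- by move=> n; exact: comb_nonempty.
- rewrite -[nu n]nuc.
  exact: (comb_push (@cU _) (@U0 _) (nu0 n.+1) (@Usub _)).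
- move=> e e0; have [n nd] := mud e e0; exists n; apply: diam_restrict => //.
  move=> x y xU yU; apply: nd.
    exact: (comb_dec (fun k => (mup k).1) muc (leq_addr n0 n)) xU.
  exact: (comb_dec (fun k => (mup k).1) muc (leq_addr n0 n)) yU.
exists a; split=> // t t0.
have nut n : \sum_i nu n i = t.
  by elim: n => // n <-; rewrite -[nu n]nuc sum_push.
move=> n; apply: closureS (hull_dec (leq_addr n0 n)) _ _.
apply/closure_normP => e e0; have /closure_normP := aP n.
case/(_ (t * e) (mulr_gt0 t0 e0)) => y [u [Uu ->]] ay.
exists (t^-1 *: \sum_i nu n i *: u i).
  exists (fun i => t^-1 * nu n i); split.
    split=> [i|]; first by rewrite mulr_ge0// invr_ge0 ltW.
    by rewrite -mulr_sumr nut mulVf// gt_eqF.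
  exists u; split=> //; rewrite scaler_sumr; apply: eq_bigr => i _.
  by rewrite scalerA.
rewrite -scalerBr normrZ ger0_norm ?invr_ge0 ?ltW//.
by rewrite ltr_pdivrMl.
Qed.

(** The first hypothesis makes a weight determine its point, the second keeps some level away from
    [z]. Splitting [mu] into the descendants of a node of positive mass and the rest writes [z] as a
    proper convex combination. *)
Lemma core_no_extreme :
  (forall (mu : forall n, I n -> R) z,
    (forall n, prob_weight (mu n)) -> consistent mu ->
    (forall n, closure (comb (mu n) (U n)) z) ->
    forall e, 0 < e -> exists n, diam_le (comb (mu n) (U n)) e) ->
  (forall z, exists n (r : R), 0 < r /\ forall i x, U n i x -> r <= `|x - z|) ->
  forall z, ~ extreme_point core z.
Proof.
move=> good avoid z [Kz zext].
have [mu [mup muc muz]] := core_weights Kz.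
have mud := good mu z mup muc muz.
have [n0 [r [r0 rP]]] := avoid z.
have [i mui] : exists i, 0 < mu n0 i.
  apply: contrapT => nex; have := (mup n0).2; rewrite big1.
    by move=> /eqP; rewrite eq_sym oner_eq0.
  move=> i _; apply: le_anti; rewrite (mup n0).1 andbT leNgt.
  by apply/negP => mui; apply: nex; exists i.
pose P n : pred (I (n + n0)%N) := fun j => ancestor j == i.
have [a [aP aK]] := restricted_point mup muc mud (P := P) (fun n j => erefl).
have [b [bP bK]] := restricted_point mup muc mud (P := fun n => predC (P n))
  (fun n j => erefl).
have tE : \sum_j restrict_weight (P 0%N) (mu n0) j = mu n0 i.
  rewrite (bigD1 i)//= /restrict_weight /P /= eqxx big1 ?addr0// => j ji.
  by rewrite (negbTE ji).
have t'E : \sum_j restrict_weight (predC (P 0%N)) (mu n0) j = 1 - mu n0 i.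
  rewrite -(mup n0).2 -tE -sumrB; apply: eq_bigr => j _.
  by rewrite /restrict_weight /=; case: (P 0%N j) => /=; rewrite ?subrr ?subr0.
rewrite /= tE in aK; rewrite /= t'E in bK.
set t := mu n0 i in mui tE t'E aK bK.
have zab : z = a + b.
  apply/eqP; rewrite -subr_eq0 -normr_le0 leNgt; apply/negP => d0.
  set d := `|z - (a + b)| in d0.
  (* Three approximation errors and one diameter, each at most [d / 5], cannot add up to [d]. *)
  have d4 : 0 < d / 5 by rewrite divr_gt0.
  have [n nd] := mud _ d4.
  have [x ax zx] := (closure_normP _ _).1 (muz (n + n0)%N) _ d4.
  have [y ay ya] := (closure_normP _ _).1 (aP n) _ d4.
  have [w bw wb] := (closure_normP _ _).1 (bP n) _ d4.
  have dec := comb_dec (fun k => (mup k).1) muc (leq_addr n0 n).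
  have xyw := nd _ _ (dec _ ax) (dec _ (comb_restrictD ay bw)).
  have : d <= `|z - x| + `|x - (y + w)| + (`|a - y| + `|b - w|).
    have -> : d = `|(z - x) + (x - (y + w)) - ((a - y) + (b - w))|.
      by rewrite addrA subrK [a - y + _]addrACA -opprD opprB addrA subrK.
    apply: le_trans (ler_normB _ _) _; apply: lerD; exact: ler_normD.
  lra.
(* At level [n0] only node [i] carries restricted weight, so [a] is close to [t] times a point of
   [U n0 i], a set at distance at least [r] from [z]. *)
have za : z != t^-1 *: a.
  apply/eqP => za; have /closure_normP := aP 0%N.
  case/(_ (t * r) (mulr_gt0 mui r0)) => y [u [Uu ye]].
  have {ye}-> : y = t *: u i.
    rewrite ye (bigD1 i)//= /restrict_weight /P /= eqxx big1 ?addr0// => j ji.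
    by rewrite (negbTE ji) scale0r.
  have -> : a - t *: u i = t *: (z - u i).
    by rewrite za scalerBr scalerA mulfV ?scale1r// gt_eqF.
  rewrite normrZ gtr0_norm// ltr_pM2l// distrC.
  by rewrite ltNge (rP _ _ (Uu i)).
(* For [t = 1] the complementary weight vanishes, so [b = 0] and [z = a]. *)
have t1 : t < 1.
  rewrite lt_neqAle (prob_weight_le1 i (mup n0)) andbT; apply/eqP => t1.
  have w0 j : restrict_weight (predC (P 0%N)) (mu n0) j = 0.
    move: t'E; rewrite t1 subrr => /eqP; rewrite psumr_eq0.
      by move=> /allP/(_ j (mem_index_enum _))/eqP.
    by move=> k _; rewrite /restrict_weight; case: ifP => // _; exact: (mup _).1.
  have b0 : b = 0.
    apply/eqP; rewrite -normr_le0 leNgt; apply/negP => nb.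
    have [y [u [_ ->]]] := (closure_normP _ _).1 (bP 0%N) _ nb.
    by rewrite big1 ?subr0 ?ltxx// => j _; rewrite [restrict_weight _ _ _]w0 scale0r.
  by move/eqP: za; apply; rewrite t1 invr1 scale1r zab b0 addr0.
have ze : z = t *: (t^-1 *: a) + (1 - t) *: ((1 - t)^-1 *: b).
  by rewrite !scalerA !mulfV ?scale1r ?gt_eqF ?subr_gt0.
(* Extremality identifies the two normalised parts, and then both equal [z], against [za]. *)
have := zext _ _ t (aK mui) (bK _) mui t1 ze; rewrite subr_gt0 => /(_ t1) ab.
move/eqP: za; apply; rewrite {1}ze -ab -scalerDl addrC subrK scale1r//.
Qed.

End Tower.

(** * Refining a level *)

Section Levels.
Variables (R : realType) (X : normedModType R).
Variables (D : set X) (tau : set (set X)) (C : set X) (M : R).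
Hypothesis tauT : is_topology_on D tau.
Hypothesis tauC : tau_locally_convex tau.
Hypothesis tauW : contains_weak D tau.
Hypothesis tauS : tau_strongly_regular D tau.
Hypothesis CD : C `<=` D.
Hypothesis CM : forall x, C x -> `|x| <= M.

Definition node (W : set X) : Prop :=
  [/\ convexS W, W !=set0 & rel_open tau C W].

Lemma node_sub W : node W -> W `<=` C.
Proof. by move=> [_ _ [V [_ ->]]]; exact: subIsetr. Qed.

Lemma tauI U V : tau U -> tau V -> tau (U `&` V).
Proof. by case: tauT => _ [_ [_ [tI _]]]; exact: tI. Qed.

(** The trace of the slab on [D] is weakly open, hence in [tau]. *)
Lemma node_slab (W : set X) (g : X -> R) (a : X) (d : R) :
  node W -> dual_elt g -> W a -> 0 < d ->
  node (W `&` [set y | `|g y - g a| < d]).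
Proof.
move=> [cW W0 [V [tV WE]]] gl Wa d0; have gL := gl.1.
have gZ0 : g 0 = 0 by have := gL 1 0 0; rewrite scale1r addr0; lra.
have gZ s x : g (s *: x) = s * g x by have := gL s x 0; rewrite addr0 gZ0 addr0.
split.
- move=> x y t [Wx gx] [Wy gy] t0 t1; split; first exact: cW.
  rewrite /= in gx gy *; rewrite gL gZ.
  have -> : t * g x + (1 - t) * g y - g a = t * (g x - g a) + (1 - t) * (g y - g a).
    by ring.
  apply: le_lt_trans (ler_normD _ _) _.
  rewrite !normrM (ger0_norm t0) (ger0_norm (x := 1 - t)) ?subr_ge0//.
  exact: convex_comb_lt.
- by exists a; split=> //=; rewrite subrr normr0.
- pose O := D `&` [set y | `|g y - g a| < d].
  have tO : tau O.
    apply: tauW; split=> [|x [Dx /= gx]]; first exact: subIsetl.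
    exists 1%N, (fun _ => g), (d - `|g x - g a|); split=> //; split.
      by rewrite subr_gt0.
    move=> y Dy /(_ ord0) yx; split=> //=.
    have -> : g y - g a = (g y - g x) + (g x - g a) by ring.
    by apply: le_lt_trans (ler_normD _ _) _; rewrite -ltrBrDr.
  exists (V `&` O); split; first exact: tauI.
  rewrite WE; apply/seteqP; split=> x [[Vx xx] yx]; last by case: xx.
  by do !split=> //; exact: CD.
Qed.

Definition dichotomy (I : finType) (w : I -> R) (U : I -> set X) (c : X) (r : R) :=
  diam_le (comb w U) r \/ forall x, comb w U x -> r / 4 <= `|x - c|.

Lemma comb_subset (I : finType) (w : I -> R) (U V : I -> set X) :
  (forall i, U i `<=` V i) -> comb w U `<=` comb w V.
Proof. by move=> UV _ [u [Uu ->]]; exists u; split=> // i; exact: UV. Qed.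

Lemma dichotomy_subset (I : finType) (w : I -> R) (U V : I -> set X) c r :
  (forall i, U i `<=` V i) -> dichotomy w V c r -> dichotomy w U c r.
Proof.
move=> /(@comb_subset _ w) UV [Vr|Vr]; [left=> x y Ux Uy|right=> x Ux].
  by apply: Vr; exact: UV.
by apply: Vr; exact: UV.
Qed.

(** A sum of diameter above [r] has a point farther than [r / 2] from [c]. Take a functional norming
    the difference of that point and [c], and cut each [U i] by a slab around its component: the
    functional then varies by at most [r / 4], which leaves [r / 4]. *)
Lemma shrink_dichotomy (I : finType) (w : I -> R) (U : I -> set X) c r :
  0 < r -> (forall i, node (U i)) ->
  exists V, (forall i, node (V i) /\ V i `<=` U i) /\ dichotomy w V c r.
Proof.
move=> r0 nU; have [Ur|] := pselect (diam_le (comb w U) r).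
  by exists U; split=> [i|]; [split|left].
move=> /existsNP[x /existsNP[y /not_implyP[Ux /not_implyP[Uy /negP]]]].
rewrite -ltNge => rxy.
have [_ [u [Uu ->]] ur] : exists2 z, comb w U z & r / 2 < `|z - c|.
  have [xc|xc] := ltP (r / 2) `|x - c|; first by exists x.
  exists y => //; have := ler_distD c x y; rewrite (distrC c y); lra.
set v := \sum_i w i *: u i - c in ur.
have [g [gl gn gv]] := norming_functional v.
have gL := gl.1.
have gZ0 : g 0 = 0 by have := gL 1 0 0; rewrite scale1r addr0; lra.
have gD a b : g (a + b) = g a + g b by have := gL 1 a b; rewrite scale1r mul1r.
have gZ s a : g (s *: a) = s * g a by have := gL s a 0; rewrite addr0 gZ0 addr0.
pose S := \sum_i `|w i| + 1.
have S0 : 0 < S by rewrite ltr_wpDl// sumr_ge0.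
have d0 : 0 < r / 4 / S by rewrite !divr_gt0.
exists (fun i => U i `&` [set y | `|g y - g (u i)| < r / 4 / S]); split.
  by move=> i; split; [exact: node_slab|exact: subIsetl].
right=> _ [u' [Uu' ->]].
have := gn (\sum_i w i *: u' i - c); apply: le_trans.
have -> : \sum_i w i *: u' i - c = v + \sum_i w i *: (u' i - u i).
  rewrite /v addrAC; congr (_ - _); rewrite -big_split/=.
  by apply: eq_bigr => i _; rewrite scalerBr addrC subrK.
have gsum : g (\sum_i w i *: (u' i - u i)) = \sum_i w i * (g (u' i) - g (u i)).
  rewrite (big_morph g gD gZ0); apply: eq_bigr => i _.
  by rewrite gZ -scaleN1r addrC gL mulN1r addrC.
rewrite gD gv gsum.
have : `|\sum_i w i * (g (u' i) - g (u i))| <= r / 4.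
  apply: le_trans (ler_norm_sum _ _ _) _.
  apply: (@le_trans _ _ (\sum_i `|w i| * (r / 4 / S))).
    apply: ler_sum => i _; rewrite normrM ler_wpM2l//.
    by case: (Uu' i) => _ /ltW.
  rewrite -mulr_suml [leLHS]mulrA ler_pdivrMr// mulrC.
  by rewrite ler_wpM2l ?divr_ge0 ?ltW// /S ltrDl.
rewrite ler_norml => /andP[h _].
by apply: le_trans (ler_norm _); lra.
Qed.

Lemma shrink_dichotomies (I T : finType) (w : T -> I -> R) (U : I -> set X) c r :
  0 < r -> (forall i, node (U i)) ->
  exists V, (forall i, node (V i) /\ V i `<=` U i) /\
    forall t, dichotomy (w t) V c r.
Proof.
move=> r0 nU.
suff [V [VU Vd]] : exists V, (forall i, node (V i) /\ V i `<=` U i) /\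
    forall t, t \in enum T -> dichotomy (w t) V c r.
  by exists V; split=> // t; apply: Vd; rewrite mem_enum.
elim: (enum T) => [|t s [V [VU Vd]]].
  by exists U; split=> // i; split.
have [W [WV Wd]] := shrink_dichotomy (w t) c r0 (fun i => (VU i).1).
exists W; split=> [i|t'].
  by split; [case: (WV i)|exact: subset_trans (WV i).2 (VU i).2].
rewrite inE => /predU1P[->//|/Vd]; apply: dichotomy_subset => i.
exact: (WV i).2.
Qed.

(** Compared with [dichotomy], the constants absorb a displacement of [r / 8] of each point:
    [r + r / 4 <= 2 * r] and [r / 4 - r / 8 = r / 8]. *)
Definition dichotomy01 (I : finType) (U : I -> set X) (c : X) (r : R) :=
  forall mu : I -> R, (forall i, 0 <= mu i <= 1) ->
    diam_le (comb mu U) (2 * r) \/ forall x, comb mu U x -> r / 8 <= `|x - c|.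

(* The weights with coordinates in [{0, 1/Q, ..., 1}] form a net fine enough to
   carry the dichotomy to all weights, at the cost of worse constants. *)
Lemma shrink_dichotomy01 (I : finType) (U : I -> set X) c r :
  0 < r -> (forall i, node (U i)) ->
  exists V, (forall i, node (V i) /\ V i `<=` U i) /\ dichotomy01 V c r.
Proof.
move=> r0 nU; pose N : R := #|I|%:R.
have N0 : 0 <= N by rewrite ler0n.
(* With this [Q], rounding errors of at most [1 / Q] in the [#|I|] weights move a sum by at most
   [r / 8]. *)
pose Q := (Num.truncn (N * `|M| / (r / 8))).+1.
have QP : N * `|M| / (r / 8) < Q%:R.
  exact: truncnS_gt.
have Q0 : 0 < Q%:R :> R by rewrite ltr0n.
pose w (t : {ffun I -> 'I_Q.+1}) i : R := (t i)%:R / Q%:R.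
have [V [VU Vd]] := shrink_dichotomies w c r0 nU.
exists V; split=> // mu mu01.
pose t : {ffun I -> 'I_Q.+1} := [ffun i => inord (Num.truncn (mu i * Q%:R))].
have wt i : `|mu i - w t i| <= Q%:R^-1.
  have /andP[m0 m1] := mu01 i.
  have mQ : 0 <= mu i * Q%:R by rewrite mulr_ge0.
  have h1 : (Num.truncn (mu i * Q%:R))%:R <= mu i * Q%:R by rewrite truncn_le.
  have tE : t i = Num.truncn (mu i * Q%:R) :> nat.
    rewrite ffunE inordK// ltnS -(ler_nat R).
    by apply: le_trans h1 _; rewrite ler_piMl.
  rewrite /w tE.
  have -> : mu i - (Num.truncn (mu i * Q%:R))%:R / Q%:R =
      (mu i * Q%:R - (Num.truncn (mu i * Q%:R))%:R) / Q%:R.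
    by field; rewrite gt_eqF.
  have h2 := truncnS_gt (mu i * Q%:R).
  rewrite normrM (ger0_norm (x := Q%:R^-1)) ?invr_ge0//.
  rewrite ler_piMl ?invr_ge0// ger0_norm ?subr_ge0//.
  by move: h2; rewrite -natr1; lra.
have near_comb u : (forall i, V i (u i)) ->
    `|\sum_i mu i *: u i - \sum_i w t i *: u i| <= r / 8.
  move=> Vu; rewrite -sumrB; apply: le_trans (ler_norm_sum _ _ _) _.
  apply: (@le_trans _ _ (\sum_(i : I) Q%:R^-1 * `|M|)).
    apply: ler_sum => i _; rewrite -scalerBl normrZ; apply: ler_pM => //.
    apply: le_trans (CM _) (ler_norm _).
    by apply: (node_sub (VU i).1); exact: Vu.
  rewrite sumr_const -[leLHS]mulr_natr -mulrA ler_pdivrMl//.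
  by rewrite mulrC -/N -ler_pdivrMr ?divr_gt0// ltW.
have [wd|wd] := Vd t; [left=> _ _ [u [Vu ->]] [v [Vv ->]]|right=> _ [u [Vu ->]]].
  have := wd _ _ (ex_intro _ u (conj Vu erefl)) (ex_intro _ v (conj Vv erefl)).
  have := near_comb _ Vu; have := near_comb _ Vv.
  set a := \sum_i _; set b := \sum_i _; set a' := \sum_i _; set b' := \sum_i _.
  move=> h1 h2 h3.
  have := ler_distD b' a' a; have := ler_distD b b' a.
  rewrite (distrC b a); lra.
have := wd _ (ex_intro _ u (conj Vu erefl)).
have := near_comb _ Vu.
set a := \sum_i _; set b := \sum_i _ => h1 h2.
have := ler_distD a b c; rewrite (distrC b a); lra.
Qed.

(** Strong regularity is applied to [W] itself; local convexity shrinks the pieces to convex ones,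
    relatively open in [C] because [W] is. One sigma type holds the data so that [choice] can pick
    them for all nodes. *)
Lemma split_node (W : set X) (d : R) : node W -> 0 < d ->
  exists s : {n : nat & (('I_n -> R) * ('I_n -> set X))%type},
    [/\ prob_weight (projT2 s).1,
        forall j, node ((projT2 s).2 j) /\ (projT2 s).2 j `<=` W &
        diam_le (comb (projT2 s).1 (projT2 s).2) d].
Proof.
move=> nW d0; have [cW W0 [V [tV WE]]] := nW.
have [|//||n [l [U [l0 [l1 [UP [d' [d'd Ud]]]]]]]] := @tauS W _ _ _ cW d d0.
- by apply: subset_trans CD; exact: node_sub.
- by exists M => x Wx; apply: CM; exact: node_sub nW _ Wx.
have /choice[U' U'P] j : exists U', [/\ node U', U' `<=` W & U' `<=` U j].
  have [[V' [tV' UE]] [x Ux]] := UP j.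
  have [V'x Wx] : (V' `&` W) x by rewrite -UE.
  have [V2 [tV2 [cV2 [V2x V2V']]]] := tauC tV' V'x.
  exists (V2 `&` W); split; [split|exact: subIsetr|].
  - move=> a b t [? ?] [? ?] t0 t1; split; [exact: cV2|exact: cW].
  - by exists x.
  - by exists (V2 `&` V); split; [exact: tauI|rewrite WE setIA].
  - by rewrite UE; exact: setSI.
exists (existT _ n (l, U')); split=> //= [j|x y xU yU].
  by case: (U'P j).
have sub : comb l U' `<=` conv_comb l U.
  by apply: comb_subset => j; case: (U'P j).
exact: le_trans (Ud _ _ (sub _ xU) (sub _ yU)) (ltW d'd).
Qed.

Record level := Level {
  level_index : finType;
  level_weight : level_index -> R;
  level_set : level_index -> set X;
  level_prob : prob_weight level_weight;
  level_node : forall i, node (level_set i) }.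

Definition refines (c : X) (r : R) (L L' : level)
    (p : level_index L' -> level_index L) : Prop :=
  [/\ forall j, level_set j `<=` level_set (p j),
      push p (@level_weight L') = @level_weight L,
      diam_le (comb (@level_weight L') (@level_set L')) r &
      dichotomy01 (@level_set L') c r].

(** Each node is split separately, and product weights push forward to the old ones. The dichotomy
    is imposed last, since shrinking the sets preserves the rest. *)
Lemma exists_refinement (c : X) (r : R) (L : level) : 0 < r ->
  exists L' (p : level_index L' -> level_index L), refines c r p.
Proof.
case: L => I w U [w0 w1] nU r0.
have /choice[s sP] i := split_node (nU i) r0.
pose J : finType := {i : I & 'I_(projT1 (s i))}.
pose w' (j : J) := w (tag j) * (projT2 (s (tag j))).1 (tagged j).
pose V (j : J) := (projT2 (s (tag j))).2 (tagged j).
have nV j : node (V j) by case: (sP (tag j)) => _ /(_ (tagged j))[].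
have VU j : V j `<=` U (tag j) by case: (sP (tag j)) => _ /(_ (tagged j))[].
have [V' [V'P V'd]] := shrink_dichotomy01 c r0 nV.
have pw : push (fun j : J => tag j) w' = w.
  apply/funext => i; rewrite /push /w'.
  rewrite (sum_tagged (pred1 i)) big_pred1_eq /= -mulr_sumr.
  by case: (sP i) => -[_ ->] _ _; exact: mulr1.
have w'P : prob_weight w'.
  split=> [j|]; last by rewrite -w1 -pw sum_push.
  by rewrite mulr_ge0//; case: (sP (tag j)) => -[].
exists (Level w'P (fun j => (V'P j).1)), (fun j : J => tag j); split=> //=.
  by move=> j; exact: subset_trans (V'P j).2 (VU j).
move=> _ _ [u [Vu ->]] [v [Vv ->]].
(* The difference is the [w]-average of differences in the blocks, each of norm at most [r]. *)
rewrite -sumrB (sum_tagged xpredT) /=.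
apply: le_trans (ler_norm_sum _ _ _) _; rewrite -[leRHS]mul1r -w1 mulr_suml.
apply: ler_sum => i _; case: (sP i) => _ _ sd; rewrite /w' /=.
set l := (projT2 (s i)).1 in sd *.
under eq_bigr do rewrite -!scalerA -scalerBr.
rewrite -scaler_sumr normrZ ger0_norm// ler_wpM2l// sumrB.
apply: sd.
  exists (fun k => u (existT (fun i => 'I_(projT1 (s i))) i k)); split=> // k.
  exact: (V'P (existT (fun i => 'I_(projT1 (s i))) i k)).2 (Vu _).
exists (fun k => v (existT (fun i => 'I_(projT1 (s i))) i k)); split=> // k.
exact: (V'P (existT (fun i => 'I_(projT1 (s i))) i k)).2 (Vv _).
Qed.

End Levels.

(** * Choice of the data and conclusion *)

Lemma dense_sequence (R : realType) (X : normedModType R) : separable_space X ->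
  exists x : nat -> X, forall z e, 0 < e -> exists k, `|z - x k| < e.
Proof.
move=> [S [/countable_injP[f finj] Sd]].
(* Numbers outside the image of [f] on [S] get the default 0, which does no harm to density. *)
exists (fun n => xget 0 [set y | S y /\ f y = n]) => z e e0.
have /closure_normP/(_ e e0)[y Sy zy] : closure S z by rewrite Sd.
exists (f y); case: xgetP => [y' _ [Sy' /finj->//]|/(_ y) []//]; exact: mem_set.
Qed.

Lemma not_CPCP_witness (R : realType) (X : normedModType R) (D : set X)
    (tau : set (set X)) : ~ tau_CPCP D tau ->
  exists C e, [/\ C `<=` D, C !=set0, boundedS C & convexS C] /\ 0 < e /\
    forall W, rel_open tau C W -> W !=set0 -> ~ diam_lt W e.
Proof.
move=> nC; apply: contrapT => nex; apply: nC => C CD C0 bC cC e e0.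
apply: contrapT => nW; apply: nex; exists C, e; do !split=> //.
by move=> W oW W0 dW; apply: nW; exists W.
Qed.

Theorem theorem2p6 (R : realType) (X : completeNormedModType R)
  (D : set X) (tau : set (set X)) :
  separable_space X ->
  closed D -> boundedS D -> convexS D ->
  is_topology_on D tau -> tau_locally_convex tau -> contains_weak D tau ->
  tau_strongly_regular D tau -> ~ tau_CPCP D tau ->
  (exists K : set X, K `<=` D /\ K !=set0 /\ closed K /\ convexS K /\
     forall x, ~ extreme_point K x) /\ ~ KMP D.
Proof.
move=> sepX clD _ _ tauT tauC tauW tauS.
move=> /not_CPCP_witness[C [e0 [[CD C0 [M CM] cC] [e00 nd]]]].
suff ex : exists K : set X, K `<=` D /\ K !=set0 /\ closed K /\ convexS K /\
     forall x, ~ extreme_point K x.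
  split=> // kmp; have [K [KD [K0 [clK [cK Kx]]]]] := ex.
  by have [x /Kx] := kmp K KD K0 clK cK.
have [x xd] := dense_sequence sepX.
(* An enumeration of all pairs of a centre and a radius; numbers that decode to nothing give
   [(0, 0)]. *)
pose code n := odflt (0%N, 0%N) (unpickle n) : nat * nat.
pose c n := x (code n).1; pose r n : R := (code n).2.+1%:R^-1.
have r0 n : 0 < r n by rewrite invr_gt0.
(* The margin [r n / 16] is half of the [r n / 8] in [dichotomy01], so that lower bounds on
   distances transfer from [c n] to [z]. *)
have cr z d : 0 < d -> exists n, 2 * r n < d /\ `|z - c n| < r n / 16.
  move=> d0; have d2 : 0 < d / 2 by rewrite divr_gt0.
  have [m _ /(_ m (leqnn m)) /= md] := near_infty_natSinv_lt (PosNum d2).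
  have m0 : 0 < m.+1%:R^-1 / 16 :> R by rewrite divr_gt0// invr_gt0.
  have [k zk] := xd z _ m0.
  exists (pickle (k, m)); rewrite /r /c /code pickleK /=; split=> //.
  by rewrite mulrC -ltr_pdivlMr.
have nC : node tau C C.
  split=> //; exists D; split; first by case: tauT => _ [].
  by apply/esym/setIidr.
have pw0 : prob_weight (fun _ : unit => 1 : R).
  by split=> //; rewrite big_const card_unit /= addr0.
pose L0 := Level pw0 (fun _ : unit => nC).
have step n (L : level tau C) :
    {L' : level tau C & {p : level_index L' -> level_index L | refines (c n) (r n) p}}.
  have /cid[L' /cid[p ?]] := exists_refinement tauT tauC tauW tauS CD CM (c n) L (r0 n).
  by exists L', p.
pose L := fix L n := if n is m.+1 then projT1 (step m (L m)) else L0.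
pose p n : level_index (L n.+1) -> level_index (L n) := sval (projT2 (step n (L n))).
have Lp n : refines (c n) (r n) (@p n) by exact: svalP (projT2 (step n (L n))).
pose U n := @level_set _ _ _ _ (L n).
pose lam n := @level_weight _ _ _ _ (L n).
have nU n i : node tau C (U n i) by exact: level_node.
have cU n i : convexS (U n i) by case: (nU n i).
have U0 n i : U n i !=set0 by case: (nU n i).
have Usub n (j : level_index (L n.+1)) : U n.+1 j `<=` U n (p n j).
  by have [+ _ _ _] := Lp n; exact.
have UM n i y : U n i y -> `|y| <= M by move=> Uy; apply: CM; exact: node_sub (nU n i) _ Uy.
(* Stage [n] acts on level [n.+1]; level 0 is the bare root [C]. *)
have Ud n : dichotomy01 (U n.+1) (c n) (r n) by case: (Lp n).
exists (core U); split; [|split; [|split; [|split]]].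
(* The hull at level 0 lies in the convex set [C], and [D] is closed. *)
- move=> z /(_ 0%N) Kz; apply: clD; apply: closureS Kz.
  move=> _ [w [[w0 w1] [u [Uu ->]]]]; apply: CD.
  have [//|//|i _|i _|y Cy ->] := @convex_cone_sum R X C _ (index_enum _) xpredT w u.
  - exact: w0.
  - exact: Uu.
  by rewrite w1 scale1r.
- apply: (core_nonempty cU U0 Usub (nu := lam)) => [n|n|d d0].
  + exact: level_prob.
  + by case: (Lp n).
  + have [n [rn _]] := cr 0 d d0; exists n.+1 => a b aU bU.
    case: (Lp n) => _ _ /(_ a b aU bU) ab _; apply: le_trans ab _.
    by have := r0 n; lra.
- exact: closed_core.
- exact: convex_core.
apply: (core_no_extreme cU U0 Usub UM) => [mu z mup muc muz d d0|z].
  have [n [rn zn]] := cr z d d0; exists n.+1.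
  have [|dn|far] := Ud n (mu n.+1).
  - by move=> i; rewrite (mup _).1 (prob_weight_le1 _ (mup _)).
  - by move=> a b aU bU; apply: le_trans (dn a b aU bU) (ltW rn).
  (* Some point of the sum is within [r n / 16] of [z], hence within [r n / 8] of [c n], which rules
     out [far]. *)
  have r16 : 0 < r n / 16 by rewrite divr_gt0.
  have [y yU zy] := (closure_normP _ _).1 (muz n.+1) _ r16.
  have := far y yU; have := ler_distD z y (c n); rewrite (distrC y z); lra.
have [n [rn zn]] := cr z e0 e00; exists n.+1, (r n / 16); split; first by rewrite divr_gt0.
(* For the point mass [mu] at [i] the sum contains [U n.+1 i], whose diameter is not below [e0],
   while [2 * r n < e0]; so only [far] remains. *)
move=> i y Uy; pose mu (j : level_index (L n.+1)) : R := (j == i)%:R.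
have Ucomb a : U n.+1 i a -> comb mu (U n.+1) a.
  move=> Ua; have [u Uu] := choice (U0 n.+1).
  exists (fun j => if j == i then a else u j); split=> [j|].
    by case: eqP => [->|].
  rewrite (bigD1 i)//= /mu eqxx scale1r big1 ?addr0// => j /negbTE->.
  by rewrite scale0r.
have [|dn|far] := Ud n mu.
- by move=> j; rewrite /mu; case: (j == i); rewrite /= ?lexx ler01.
- case: (nd (U n.+1 i)) => //; first by case: (nU n.+1 i).
  by exists (2 * r n); split=> // a b Ua Ub; apply: dn; exact: Ucomb.
have := far y (Ucomb y Uy); have := ler_distD z y (c n); lra.
Qed.
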